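(* Let $A\in\mathbb{R}^{n\times n}$ and $C_i\in\mathbb{R}^{s_i\times n}$, $i\in\mathbf{m}=\{1,\dots,m\}$, $m>1$, and suppose the system $\dot x=Ax$, $y_i=C_ix$ is jointly observable. Let $\mathcal{P}$ be a finite index set and, for each $p\in\mathcal{P}$, let $\mathbb{N}(p)$ be a strongly connected directed graph on the vertex set $\mathbf{m}$ with a self-loop at each vertex, such that the matrix $S(p)$ is doubly stochastic. Let $\lambda>0$. Then there exist matrices $K_i\in\mathbb{R}^{n\times s_i}$, $i\in\mathbf{m}$, and a number $g_0>0$ such that for every $g\ge g_0$ there is a constant $c>0$ with the following property: for every switching signal $\sigma:[0,\infty)\to\mathcal{P}$ (no dwell-time restriction), every initial state $x(0)$ and all initial estimator states $x_i(0)$, the solutions of the system and of the distributed observer $$\dot{x}_i = (A+K_iC_i)x_i -K_iy_i -gP_i\Big(x_i-\frac{1}{m_i(\sigma(t))}\sum_{j\in\mathcal{N}_i(\sigma(t))} x_j\Big),\quad i\in\mathbf{m},$$ satisfy $\|e(t)\|\le c\,e^{-\lambda t}\|e(0)\|$ for all $t\ge0$, where $e=\mathrm{column}\{x_1-x,\dots,x_m-x\}$.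
   Context: Joint observability means the pair $(C,A)$ with $C=[C_1'\ \cdots\ C_m']'$ is observable, equivalently $\bigcap_{i}\mathcal{V}_i=0$, where $\mathcal{V}_i$ is the unobservable subspace of $(C_i,A)$ (the largest $A$-invariant subspace contained in $\ker C_i$). $P_i$ denotes the orthogonal projection onto $\mathcal{V}_i$. For $p\in\mathcal{P}$, $\mathcal{N}_i(p)$ is the set of $j$ such that there is an arc from $j$ to $i$ in $\mathbb{N}(p)$ (so $i\in\mathcal{N}_i(p)$), and $m_i(p)$ is the number of elements of $\mathcal{N}_i(p)$. $S(p)=D_{\mathbb{N}(p)}^{-1}A_{\mathbb{N}(p)}'$, where $A_{\mathbb{N}(p)}$ is the adjacency matrix of $\mathbb{N}(p)$ (entry $(j,i)$ equal to 1 iff there is an arc from $j$ to $i$) and $D_{\mathbb{N}(p)}$ is the diagonal matrix of in-degrees; thus $S(p)_{ij}=1/m_i(p)$ if $j\in\mathcal{N}_i(p)$ and $0$ otherwise. Doubly stochastic means all row sums and all column sums equal 1. A switching signal is a piecewise-constant, right-continuous map $\sigma:[0,\infty)\to\mathcal{P}$ with finitely many discontinuities on each bounded interval. $g>0$ is a scalar gain. *)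

(* Defs.v *)
From Stdlib Require Import Reals Lra Relations.
Open Scope R_scope.

(* Vectors are nat -> R (only indices < dimension matter);
   matrices are nat -> nat -> R (row, column). Agents are 0..m-1. *)

Fixpoint rsum (k : nat) (f : nat -> R) : R :=
  match k with O => 0 | S k' => rsum k' f + f k' end.

Fixpoint cnt (k : nat) (b : nat -> bool) : nat :=
  match k with O => O | S k' => (cnt k' b + if b k' then 1 else 0)%nat end.

Definition mv (n : nat) (M : nat -> nat -> R) (v : nat -> R) : nat -> R :=
  fun i => rsum n (fun k => M i k * v k).

Definition dot (n : nat) (u v : nat -> R) : R := rsum n (fun k => u k * v k).

(* Unobservable subspace of (C, A), C of size s x n, A of size n x n:
   the largest A-invariant subspace contained in ker C,
   i.e. { x | C A^k x = 0 for all k }. *)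
Definition unobs (n s : nat) (C A : nat -> nat -> R) (x : nat -> R) : Prop :=
  forall k r, (r < s)%nat -> mv n C (Nat.iter k (mv n A) x) r = 0.

Definition jointly_observable (n m : nat) (s : nat -> nat)
  (C : nat -> nat -> nat -> R) (A : nat -> nat -> R) : Prop :=
  forall x : nat -> R,
    (forall i, (i < m)%nat -> unobs n (s i) (C i) A x) ->
    forall k, (k < n)%nat -> x k = 0.

Definition is_orth_proj (n : nat) (V : (nat -> R) -> Prop)
  (P : nat -> nat -> R) : Prop :=
  (forall x, V (mv n P x)) /\
  (forall x y, V y -> dot n (fun k => x k - mv n P x k) y = 0).

(* Graphs on vertex set {0..m-1}: arc G j i = true iff there is an arc j -> i *)
Definition graph_edge (m : nat) (G : nat -> nat -> bool) : nat -> nat -> Prop :=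
  fun a b => (a < m)%nat /\ (b < m)%nat /\ G a b = true.

Definition strongly_connected (m : nat) (G : nat -> nat -> bool) : Prop :=
  forall i j, (i < m)%nat -> (j < m)%nat ->
    clos_refl_trans nat (graph_edge m G) i j.

Definition self_loops (m : nat) (G : nat -> nat -> bool) : Prop :=
  forall i, (i < m)%nat -> G i i = true.

Definition indeg (m : nat) (G : nat -> nat -> bool) (i : nat) : nat :=
  cnt m (fun j => G j i).

(* S = D^{-1} A' : S i j = 1/m_i if j in N_i, 0 otherwise *)
Definition Smat (m : nat) (G : nat -> nat -> bool) : nat -> nat -> R :=
  fun i j => if G j i then / INR (indeg m G i) else 0.

Definition doubly_stochastic (m : nat) (M : nat -> nat -> R) : Prop :=
  (forall i j, (i < m)%nat -> (j < m)%nat -> 0 <= M i j) /\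
  (forall i, (i < m)%nat -> rsum m (fun j => M i j) = 1) /\
  (forall j, (j < m)%nat -> rsum m (fun i => M i j) = 1).

(* Switching signal: piecewise constant, right-continuous, finitely many
   discontinuities on each bounded interval [0, T). *)
Definition switching_signal {Pset : Type} (sigma : R -> Pset) : Prop :=
  forall T, 0 < T ->
    exists (k : nat) (tt : nat -> R),
      tt O = 0 /\ T <= tt k /\
      (forall l, (l < k)%nat -> tt l < tt (S l)) /\
      (forall l t, (l < k)%nat -> tt l <= t < tt (S l) -> sigma t = sigma (tt l)).

Definition rderiv (f : R -> R) (t l : R) : Prop :=
  forall eps, 0 < eps -> exists delta, 0 < delta /\
    forall h, 0 < h < delta -> Rabs ((f (t + h) - f t) / h - l) < eps.

(* v : [0,oo) -> R^n solves dv/dt = F t v (right-hand side right-continuous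
   in t): continuous on [0,oo) and its right derivative equals F at every
   t >= 0. *)
Definition solves (n : nat) (v : R -> nat -> R)
  (F : R -> nat -> R) : Prop :=
  forall k, (k < n)%nat ->
    (forall t, 0 < t -> continuity_pt (fun u => v u k) t) /\
    (forall t, 0 <= t -> rderiv (fun u => v u k) t (F t k)).

Definition err_norm (n m : nat) (xs : nat -> nat -> R) (x : nat -> R) : R :=
  sqrt (rsum m (fun i => rsum n (fun k => (xs i k - x k) ^ 2))).

(* Main.v *)
(* Let [V_i] be the unobservable subspace of agent [i], [P_i] the projection onto
   it, and split the error [e_i] as [w_i + z_i] with [w_i = P_i e_i].  The part
   [z_i] does not see the coupling, and it is made to decay at any prescribed rate:
   for large [t] the Lyapunov equation [A'W + WA + tW = 2C'C] has a positive
   semidefinite solution [W_i] with kernel exactly [V_i], and a gain [K_i] with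
   [W_i K_i = - C_i'] turns it into a Lyapunov function.  For [w], double
   stochasticity makes the coupling a Dirichlet form,
   [2 sum_i w_i.(w_i - sum_j S_ij w_j) = sum_ij S_ij |w_i - w_j|^2].  If it is
   small then all [w_i] are close to each other by strong connectivity, hence
   close to every [V_j], hence small because the [V_j] meet only at [0]: the form
   is at least [mu |w|^2] on the product of the [V_i].  So for [g] large,
   [sum_i |P_i e_i|^2 + Gam_i e_i' W_i e_i] is a Lyapunov function of rate
   [2 lambda] common to all the graphs.  It decreases along every solution, since
   only right derivatives are needed to compare; the switching times play no
   role. *)

From HB Require Import structures.
Require Import Defs.
From Stdlib Require Import Reals Relations List Lra.
From mathcomp Require all_boot all_order all_algebra archimedean ring lra Rstruct.
Open Scope R_scope.

(** * Right derivatives *)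

(** Identifies the one-sided difference quotient with a [limit1_in] over [h > 0], so that the limit
    laws yield the calculus rules below. *)
Lemma rderiv_limit f t l :
  rderiv f t l <-> limit1_in (fun h => (f (t + h) - f t) / h) (fun h => 0 < h) l 0.
Proof.
split; intros H eps eps0.
- destruct (H eps eps0) as [d [d0 Hd]]; exists d; split; [exact d0|].
  intros h [h0 hd]; apply Hd; split; [exact h0|].
  simpl in hd; unfold Rdist in hd; rewrite Rminus_0_r, Rabs_pos_eq in hd; lra.
- destruct (H eps eps0) as [d [d0 Hd]]; exists d; split; [exact d0|].
  intros h [h0 hd]; apply (Hd h); split; [exact h0|].
  simpl; unfold Rdist; rewrite Rminus_0_r, Rabs_pos_eq; lra.
Qed.

Lemma rderiv_ext f g t l : (forall u, f u = g u) -> rderiv f t l -> rderiv g t l.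
Proof.
intros e H eps eps0; destruct (H eps eps0) as [d [d0 Hd]]; exists d; split; auto.
intros h hd; rewrite <- !e; auto.
Qed.

Lemma rderiv_const a t : rderiv (fun _ => a) t 0.
Proof.
intros eps eps0; exists 1; split; [lra|]; intros h hd.
replace ((a - a) / h - 0) with 0 by (field; lra); rewrite Rabs_R0; exact eps0.
Qed.

Lemma limit1_in_ext f g D l x0 : (forall x, D x -> f x = g x) ->
  limit1_in f D l x0 -> limit1_in g D l x0.
Proof.
intros e H eps eps0; destruct (H eps eps0) as [d [d0 Hd]]; exists d; split; auto.
intros x [Dx hx]; rewrite <- e by exact Dx; auto.
Qed.

Lemma rderiv_plus f g t a b : rderiv f t a -> rderiv g t b ->
  rderiv (fun u => f u + g u) t (a + b).
Proof.
rewrite !rderiv_limit; intros Hf Hg.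
refine (limit1_in_ext _ _ _ _ _ _ (limit_plus _ _ _ _ _ _ Hf Hg)).
intros h h0; simpl; field; lra.
Qed.

Lemma rderiv_mult f g t a b : rderiv f t a -> rderiv g t b ->
  rderiv (fun u => f u * g u) t (a * g t + f t * b).
Proof.
rewrite !rderiv_limit; intros Hf Hg.
assert (Hid : limit1_in (fun h => h) (fun h => 0 < h) 0 0) by apply lim_x.
assert (Hc : forall c, limit1_in (fun _ => c) (fun h => 0 < h) c 0).
{ intros c; exact (limit_free (fun _ => c) _ 0 0). }
(* Here [f (t + h)] is written as [h * ((f (t + h) - f t) / h) + f t]: a right derivative at [t]
   forces right continuity there. *)
assert (Hff := limit_plus _ _ _ _ _ _ (limit_mul _ _ _ _ _ _ Hid Hf) (Hc (f t))).
assert (Hprod := limit_plus _ _ _ _ _ _ (limit_mul _ _ _ _ _ _ Hf (Hc (g t)))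
  (limit_mul _ _ _ _ _ _ Hff Hg)).
replace (a * g t + f t * b) with (a * g t + (0 * a + f t) * b) by ring.
refine (limit1_in_ext _ _ _ _ _ _ Hprod).
intros h h0; simpl; field; lra.
Qed.

Lemma rderiv_scal c f t a : rderiv f t a -> rderiv (fun u => c * f u) t (c * a).
Proof.
intros Hf; replace (c * a) with (0 * f t + c * a) by ring.
exact (rderiv_mult _ _ _ _ _ (rderiv_const c t) Hf).
Qed.

Lemma rderiv_minus f g t a b : rderiv f t a -> rderiv g t b ->
  rderiv (fun u => f u - g u) t (a - b).
Proof.
intros Hf Hg; replace (a - b) with (a + -1 * b) by ring.
refine (rderiv_ext _ _ _ _ _ (rderiv_plus _ _ _ _ _ Hf (rderiv_scal (-1) _ _ _ Hg))).
intros u; ring.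
Qed.

Lemma derivable_rderiv f t l : derivable_pt_lim f t l -> rderiv f t l.
Proof.
intros H eps eps0; destruct (H eps eps0) as [d Hd]; exists d; split; [apply cond_pos|].
intros h hd; apply Hd; [lra|rewrite Rabs_pos_eq; lra].
Qed.

(* A supremum argument, applied to the slope [eps] for every [eps > 0] because
   the right derivative is only nonpositive. *)
Lemma rderiv_nonpos_le f :
  (forall t, 0 < t -> continuity_pt f t) ->
  (forall t, 0 <= t -> exists l, l <= 0 /\ rderiv f t l) ->
  forall T, 0 <= T -> f T <= f 0.
Proof.
intros Hcont Hder T T0.
assert (slope : forall eps, 0 < eps -> f T <= f 0 + eps * T).
{ intros eps eps0.
  set (E := fun s => 0 <= s <= T /\ forall u, 0 <= u <= s -> f u <= f 0 + eps * u).
  assert (E0 : E 0).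
  { split; [lra|]; intros u u0; replace u with 0 by lra; lra. }
  destruct (completeness E) as [tau [ub lub]].
  { exists T; intros s [hs _]; lra. }
  { exists 0; exact E0. }
  assert (tau0 : 0 <= tau) by (apply ub; exact E0).
  assert (tauT : tau <= T) by (apply lub; intros s [hs _]; lra).
  assert (below : forall u, 0 <= u < tau -> f u <= f 0 + eps * u).
  { intros u hu; destruct (Rle_dec (f u) (f 0 + eps * u)) as [h|h]; [exact h|].
    enough (tau <= u) by lra; apply lub; intros s [hs hsE].
    destruct (Rle_dec s u) as [su|su]; [exact su|].
    exfalso; apply h, hsE; lra. }
  (* If the bound failed at [tau], continuity would make it fail slightly to the left, against
     [below]. *)
  assert (at_tau : f tau <= f 0 + eps * tau).
  { destruct (Req_dec tau 0) as [->|tau1]; [lra|].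
    destruct (Rle_dec (f tau) (f 0 + eps * tau)) as [h|h]; [exact h|exfalso].
    destruct (Hcont tau) with (eps := f tau - (f 0 + eps * tau))
      as [d [d0 Hd]]; [lra|lra|].
    set (u := tau - Rmin (d / 2) (tau / 2)).
    assert (hmin : 0 < Rmin (d / 2) (tau / 2) /\ Rmin (d / 2) (tau / 2) <= d / 2
      /\ Rmin (d / 2) (tau / 2) <= tau / 2).
    { split; [apply Rmin_pos; lra|split; [apply Rmin_l|apply Rmin_r]]. }
    assert (hu : 0 <= u < tau) by (unfold u; lra).
    assert (close : Rabs (f u - f tau) < f tau - (f 0 + eps * tau)).
    { apply (Hd u); split; [split; [exact I|lra]|].
      simpl; unfold Rdist; rewrite Rabs_left; unfold u; lra. }
    apply Rabs_def2 in close; assert (hb := below u hu).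
    assert (eps * u <= eps * tau) by (apply Rmult_le_compat_l; lra).
    lra. }
  destruct (Rle_lt_or_eq_dec tau T tauT) as [lt_tau|<-]; [exfalso|exact at_tau].
  destruct (Hder tau tau0) as [l [l0 Hl]].
  destruct (Hl eps eps0) as [d [d0 Hd]].
  set (s := Rmin T (tau + d / 2)).
  assert (hs : tau < s /\ s <= T /\ s <= tau + d / 2).
  { split; [apply Rmin_glb_lt; lra|split; [apply Rmin_l|apply Rmin_r]]. }
  enough (E s) as Es by (apply ub in Es; lra).
  split; [lra|]; intros u hu.
  destruct (Rlt_le_dec u tau) as [u_tau|tau_u]; [apply below; lra|].
  destruct (Req_dec u tau) as [->|ne]; [exact at_tau|].
  assert (h := Hd (u - tau)); apply Rabs_def2 in h; [|lra].
  replace (tau + (u - tau)) with u in h by ring.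
  assert (hq : (f u - f tau) / (u - tau) < eps) by lra.
  apply (Rmult_lt_compat_r (u - tau)) in hq; [|lra].
  replace ((f u - f tau) / (u - tau) * (u - tau)) with (f u - f tau) in hq
    by (field; lra).
  lra. }
destruct (Rle_dec (f T) (f 0)) as [h|h]; [exact h|exfalso].
(* For this slope [eps * T] stays below half of [f T - f 0]; the [T + 1] avoids a zero denominator
   at [T = 0]. *)
assert (hT := slope ((f T - f 0) / (2 * (T + 1)))).
assert (0 < (f T - f 0) / (2 * (T + 1))) as pos by (apply Rdiv_lt_0_compat; lra).
specialize (hT pos).
assert ((f T - f 0) / (2 * (T + 1)) * (2 * (T + 1)) = f T - f 0) by (field; lra).
nra.
Qed.

(** * Observer design *)

(* MathComp is imported only inside modules: its notations in [nat_scope] would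
   change the meaning of [<] in the theorem. *)
Module ObserverDesign.
Import all_boot all_order all_algebra archimedean ring lra.
Set Implicit Arguments.
Unset Strict Implicit.
Unset Printing Implicit Defensive.
Import Order.TTheory GRing.Theory Num.Theory.
Local Open Scope ring_scope.

(** * Inner products, bounds for linear maps, positive semidefinite matrices *)

Section Dot.
Variable R : realFieldType.

Definition dotv n (u v : 'cV[R]_n) : R := (u^T *m v) 0 0.

Lemma dotvE n (u v : 'cV[R]_n) : dotv u v = \sum_i u i 0 * v i 0.
Proof. by rewrite /dotv mxE; apply: eq_bigr => i _; rewrite mxE. Qed.

Lemma dotvC n (u v : 'cV[R]_n) : dotv u v = dotv v u.
Proof. by rewrite !dotvE; apply: eq_bigr => i _; rewrite mulrC. Qed.

Lemma dotvDr n (u v w : 'cV[R]_n) : dotv u (v + w) = dotv u v + dotv u w.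
Proof. by rewrite /dotv mulmxDr mxE. Qed.

Lemma dotvDl n (u v w : 'cV[R]_n) : dotv (v + w) u = dotv v u + dotv w u.
Proof. by rewrite ![dotv _ u]dotvC dotvDr. Qed.

Lemma dotvZr n a (u v : 'cV[R]_n) : dotv u (a *: v) = a * dotv u v.
Proof. by rewrite /dotv -scalemxAr mxE. Qed.

Lemma dotvZl n a (u v : 'cV[R]_n) : dotv (a *: v) u = a * dotv v u.
Proof. by rewrite ![dotv _ u]dotvC dotvZr. Qed.

Lemma dotvNr n (u v : 'cV[R]_n) : dotv u (- v) = - dotv u v.
Proof. by rewrite -scaleN1r dotvZr mulN1r. Qed.

Lemma dotvNl n (u v : 'cV[R]_n) : dotv (- v) u = - dotv v u.
Proof. by rewrite ![dotv _ u]dotvC dotvNr. Qed.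

Lemma dotvBr n (u v w : 'cV[R]_n) : dotv u (v - w) = dotv u v - dotv u w.
Proof. by rewrite dotvDr dotvNr. Qed.

Lemma dotvBl n (u v w : 'cV[R]_n) : dotv (v - w) u = dotv v u - dotv w u.
Proof. by rewrite dotvDl dotvNl. Qed.

Lemma dotv0r n (u : 'cV[R]_n) : dotv u 0 = 0.
Proof. by rewrite /dotv mulmx0 mxE. Qed.

Lemma dotv0l n (u : 'cV[R]_n) : dotv 0 u = 0.
Proof. by rewrite dotvC dotv0r. Qed.

Lemma dotv_sumr n (I : Type) (r : seq I) (P : pred I) (F : I -> 'cV[R]_n) u :
  dotv u (\sum_(i <- r | P i) F i) = \sum_(i <- r | P i) dotv u (F i).
Proof.
elim/big_rec2: _ => [|i x y _ <-]; first exact: dotv0r.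
exact: dotvDr.
Qed.

Lemma dotv_mulmxr m n (M : 'M[R]_(m, n)) u v :
  dotv u (M *m v) = dotv (M^T *m u) v.
Proof. by rewrite /dotv trmx_mul trmxK mulmxA. Qed.

Definition linear_dotv := (dotvDl, dotvDr, dotvBl, dotvBr, dotvNl, dotvNr,
  dotvZl, dotvZr).

Lemma dotvv_ge0 n (u : 'cV[R]_n) : 0 <= dotv u u.
Proof. by rewrite dotvE sumr_ge0 // => i _; rewrite -expr2 sqr_ge0. Qed.

Lemma dotvv_eq0 n (u : 'cV[R]_n) : dotv u u = 0 -> u = 0.
Proof.
move=> /eqP; rewrite dotvE psumr_eq0; last by move=> i _; rewrite -expr2 sqr_ge0.
move=> /allP u0; apply/colP => i; rewrite mxE.
by have := u0 i (mem_index_enum i); rewrite /= mulf_eq0 orbb => /eqP.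
Qed.

Lemma dotv_young n (u v : 'cV[R]_n) a : 0 < a ->
  2 * dotv u v <= a * dotv u u + a^-1 * dotv v v.
Proof.
move=> a0; have := dotvv_ge0 (a *: u - v).
rewrite !linear_dotv [dotv v u]dotvC => h.
rewrite -(ler_pM2l a0) mulrDr mulrA [a * (a^-1 * _)]mulrA divff ?gt_eqF // mul1r.
by lra.
Qed.

Lemma dotv_cauchy n (u v : 'cV[R]_n) : dotv u v ^+ 2 <= dotv u u * dotv v v.
Proof.
have [/dotvv_eq0 ->|u0] := eqVneq (dotv u u) 0; first by rewrite !dotv0l expr0n mul0r.
have {u0}u0 : 0 < dotv u u by rewrite lt_neqAle eq_sym u0 dotvv_ge0.
have := dotvv_ge0 (dotv u u *: v - dotv u v *: u).
rewrite !linear_dotv [dotv v u]dotvC => h.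
rewrite -subr_ge0 -(pmulr_rge0 _ u0); apply: le_trans h _.
by rewrite le_eqVlt; apply/orP; left; apply/eqP; ring.
Qed.

(** Cauchy-Schwarz on each row gives the squared Frobenius norm as a bound; the added 1 keeps it
    positive when [M = 0]. *)
Lemma mulmx_bounded m n (M : 'M[R]_(m, n)) :
  exists2 b, 0 < b & forall v, dotv (M *m v) (M *m v) <= b * dotv v v.
Proof.
have s0 : 0 <= \sum_i dotv (row i M)^T (row i M)^T.
  by rewrite sumr_ge0 // => i _; exact: dotvv_ge0.
exists (1 + \sum_i dotv (row i M)^T (row i M)^T); first by lra.
move=> v; rewrite mulrDl mul1r mulr_suml [X in X <= _]dotvE.
apply: (@le_trans _ _ (\sum_i dotv (row i M)^T (row i M)^T * dotv v v));
  last by rewrite lerDr dotvv_ge0.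
apply: ler_sum => i _.
have -> : (M *m v) i 0 = dotv (row i M)^T v.
  by rewrite dotvE mxE; apply: eq_bigr => j _; rewrite !mxE.
by rewrite -expr2 dotv_cauchy.
Qed.

(** With [y = M x], the form at [x - s y] is [-2 s |y|^2 + s^2 y'My]. For [s = 1 / (1 + b)] the
    second term is at most [s |y|^2], so nonnegativity forces [y = 0]. *)
Lemma psd_ker n (M : 'M[R]_n) x :
  M^T = M -> (forall u, 0 <= dotv u (M *m u)) -> dotv x (M *m x) = 0 -> M *m x = 0.
Proof.
move=> symM M_ge0 xMx; apply: dotvv_eq0.
set y := M *m x; have [b b0 hb] := mulmx_bounded M.
have yMy : dotv y (M *m y) <= (1 + b) * dotv y y.
  have := dotv_young y (M *m y) ltr01; have := hb y.
  rewrite invr1 !mul1r => h1 h2; have := dotvv_ge0 y; have := dotvv_ge0 (M *m y).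
  by nra.
have := M_ge0 (x - (1 + b)^-1 *: y).
have xMy : dotv x (M *m y) = dotv y y by rewrite dotv_mulmxr symM.
rewrite mulmxBr -scalemxAr !linear_dotv xMx xMy -/y => h.
have b1 : 0 < (1 + b)^-1 by rewrite invr_gt0; lra.
have e : (1 + b)^-1 * ((1 + b) * dotv y y) = dotv y y.
  by rewrite mulrA mulVf ?mul1r // gt_eqF //; lra.
have := ler_wpM2l (ltW b1) yMy; rewrite e => h2.
apply/eqP; rewrite eq_le dotvv_ge0 andbT -(pmulr_rle0 _ b1).
by have := ler_wpM2l (ltW b1) h2; lra.
Qed.

Lemma unitmx_ker0 n (M : 'M[R]_n) :
  (forall x : 'cV_n, M *m x = 0 -> x = 0) -> M \in unitmx.
Proof.
move=> M0; rewrite -unitmx_tr -row_free_unit -kermx_eq0; apply/eqP.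
apply/row_matrixP => i; rewrite row0.
have : row i (kermx M^T) *m M^T = 0 by rewrite -row_mul mulmx_ker row0.
move=> /(congr1 trmx); rewrite trmx_mul trmxK trmx0 => /M0.
by move=> /(congr1 trmx); rewrite trmxK trmx0.
Qed.

Lemma pd_unitmx n (M : 'M[R]_n) :
  (forall x, dotv x (M *m x) = 0 -> x = 0) -> M \in unitmx.
Proof. by move=> M0; apply: unitmx_ker0 => x e; apply: M0; rewrite e dotv0r. Qed.

(* Minimising over [s] the nonnegative form at [s x - M^-1 x] bounds [x'Mx] from
   below by [|x|^2 / |M^-1|]; this replaces a compactness argument. *)
Lemma pd_lower_bound n (M : 'M[R]_n) :
  M^T = M -> (forall x, 0 <= dotv x (M *m x)) ->
  (forall x, dotv x (M *m x) = 0 -> x = 0) ->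
  exists2 nu, 0 < nu & forall x, nu * dotv x x <= dotv x (M *m x).
Proof.
move=> symM M_ge0 M0; have Mu := pd_unitmx M0.
have [b b0 hb] := mulmx_bounded (invmx M).
pose c := 1 + b; have c0 : 0 < c by rewrite /c; lra.
exists c^-1; first by rewrite invr_gt0.
move=> x; pose y := invmx M *m x; have My : M *m y = x by rewrite mulKVmx.
have := M_ge0 (c *: x - y); rewrite mulmxBr -scalemxAr My !linear_dotv.
have -> : dotv y (M *m x) = dotv x x by rewrite dotv_mulmxr symM My.
have := dotv_young y x ltr01; rewrite invr1 !mul1r.
have := hb x; rewrite -/y => h1 h2 h3.
rewrite -(ler_pM2l c0) mulrA divff ?gt_eqF // mul1r -(ler_pM2l c0).
have := dotvv_ge0 x; rewrite /c in h3 *; nra.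
Qed.

End Dot.

(** * Unique solvability of Sylvester equations with a large shift *)

Section Lyapunov.
Variable R : realFieldType.

Definition norm1 m n (M : 'M[R]_(m, n)) : R := \sum_i \sum_j `|M i j|.

Lemma norm1_ge0 m n (M : 'M[R]_(m, n)) : 0 <= norm1 M.
Proof. by rewrite sumr_ge0 // => i _; rewrite sumr_ge0. Qed.

Lemma norm1_eq0 m n (M : 'M[R]_(m, n)) : norm1 M <= 0 -> M = 0.
Proof.
move=> h; have /eqP : norm1 M = 0 by apply/eqP; rewrite eq_le h norm1_ge0.
rewrite psumr_eq0; last by move=> i _; rewrite sumr_ge0.
move=> /allP M0; apply/matrixP => i j; rewrite mxE.
have := M0 i (mem_index_enum i).
rewrite /= psumr_eq0 // => /allP /(_ j (mem_index_enum j)).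
by rewrite /= normr_eq0 => /eqP.
Qed.

Lemma norm1D m n (M N : 'M[R]_(m, n)) : norm1 (M + N) <= norm1 M + norm1 N.
Proof.
rewrite /norm1 -big_split /=; apply: ler_sum => i _.
by rewrite -big_split /=; apply: ler_sum => j _; rewrite mxE ler_normD.
Qed.

Lemma norm1Z m n a (M : 'M[R]_(m, n)) : norm1 (a *: M) = `|a| * norm1 M.
Proof.
rewrite /norm1 mulr_sumr; apply: eq_bigr => i _; rewrite mulr_sumr.
by apply: eq_bigr => j _; rewrite mxE normrM.
Qed.

Lemma norm1M m n p (M : 'M[R]_(m, n)) (N : 'M[R]_(n, p)) :
  norm1 (M *m N) <= norm1 M * norm1 N.
Proof.
rewrite /norm1 mulr_suml; apply: ler_sum => i _.
apply: (@le_trans _ _ (\sum_j \sum_k `|M i k| * `|N k j|)).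
  apply: ler_sum => j _; rewrite mxE; apply: le_trans (ler_norm_sum _ _ _) _.
  by apply: ler_sum => k _; rewrite normrM.
rewrite exchange_big /= mulr_suml; apply: ler_sum => k _.
rewrite -mulr_sumr ler_wpM2l // (bigD1 k) //= lerDl sumr_ge0 // => l _.
by rewrite sumr_ge0.
Qed.

(** Since [norm1] is submultiplicative, [t N = - (X N + N Y)] gives [t |N| <= (|X| + |Y|) |N|]. *)
Lemma sylvester_inj m n (X : 'M[R]_m) (Y : 'M[R]_n) (N : 'M[R]_(m, n)) (t : R) :
  norm1 X + norm1 Y < t -> X *m N + N *m Y + t *: N = 0 -> N = 0.
Proof.
move=> tXY e; apply: norm1_eq0.
have X0 := norm1_ge0 X; have Y0 := norm1_ge0 Y; have N0 := norm1_ge0 N.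
have tN : t *: N = - 1 *: (X *m N + N *m Y).
  by apply/eqP; rewrite scaleN1r -addr_eq0 addrC e.
have := norm1D (X *m N) (N *m Y); have := norm1M X N; have := norm1M N Y.
have := congr1 (@norm1 m n) tN.
rewrite !norm1Z normrN1 mul1r gtr0_norm; last by lra.
by nra.
Qed.

Lemma sylvester_uniq m n (X : 'M[R]_m) (Y : 'M[R]_n) (N N' : 'M[R]_(m, n)) (t : R) :
  norm1 X + norm1 Y < t ->
  X *m N + N *m Y + t *: N = X *m N' + N' *m Y + t *: N' -> N = N'.
Proof.
move=> tXY /eqP; rewrite -subr_eq0 => /eqP e.
apply/eqP; rewrite -subr_eq0; apply/eqP; apply: sylvester_inj tXY _; rewrite -{}[RHS]e.
rewrite mulmxBr mulmxBl scalerBr !opprD [RHS]addrACA; congr (_ + _).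
exact: addrACA.
Qed.

(** An injective linear endomorphism of the finite-dimensional space of matrices is onto; [lin_mx]
    represents it as a square matrix acting on [mxvec]. *)
Lemma sylvester_solve m n (X : 'M[R]_m) (Y : 'M[R]_n) (Q : 'M[R]_(m, n)) (t : R) :
  norm1 X + norm1 Y < t -> exists N, X *m N + N *m Y + t *: N = Q.
Proof.
move=> tXY; pose f (N : 'M[R]_(m, n)) := X *m N + N *m Y + t *: N.
have f_linear : linear f.
  move=> a M N; rewrite /f mulmxDr mulmxDl -scalemxAr -scalemxAl !scalerDr.
  rewrite !scalerA [t * a]mulrC [RHS]addrACA; congr (_ + _).
  exact: addrACA.
pose fL : {linear 'M[R]_(m, n) -> 'M[R]_(m, n)} :=
  HB.pack f (GRing.isLinear.Build _ _ _ _ f f_linear).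
have fu : lin_mx fL \in unitmx.
  rewrite -unitmx_tr; apply: unitmx_ker0 => x h.
  have : x^T *m lin_mx fL = 0 by rewrite -[LHS]trmxK trmx_mul trmxK h trmx0.
  rewrite -[x^T]vec_mxK mul_vec_lin => /(congr1 vec_mx); rewrite mxvecK linear0.
  move=> /(sylvester_inj tXY) /(congr1 mxvec); rewrite vec_mxK linear0.
  by move=> /(congr1 trmx); rewrite trmxK trmx0.
exists (vec_mx (mxvec Q *m invmx (lin_mx fL))).
rewrite -[LHS]/(fL _) -[LHS]mxvecK -mul_vec_lin vec_mxK mulmxKV //.
by rewrite mxvecK.
Qed.

End Lyapunov.

(** * The Lyapunov equation and the local gain of one agent *)

Section Observer.
Variable R : archiRealFieldType.

(* The Cayley transform [T = A (A + t)^-1] is a contraction for large [t], and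
   the Lyapunov equation gives [x'Wx >= (Tx)'W(Tx)]. *)
Lemma lyapunov_psd n (A : 'M[R]_n) :
  exists2 t0 : R, 0 < t0 & forall (t : R) (W Q : 'M[R]_n), t0 <= t ->
    A^T *m W + W *m A + t *: W = Q -> (forall x, 0 <= dotv x (Q *m x)) ->
    forall x, 0 <= dotv x (W *m x).
Proof.
have [b b0 hA] := mulmx_bounded A.
(* The factor 10 serves [xAy] below, where [3/4 t^2 |y|^2] has to dominate [7 |A y|^2], with
   [|A y|^2 <= b |y|^2]. *)
exists (10 * b + 1) => [|t W Q tb WQ Q_ge0]; first by lra.
have t0 : 0 < t by lra.
have t2 : 10 * b < t * t by nra.
have Atu : A + t%:M \in unitmx.
  apply: unitmx_ker0 => x /eqP; rewrite mulmxDl mul_scalar_mx addr_eq0 => /eqP Ax.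
  apply: dotvv_eq0; apply/eqP; rewrite eq_le dotvv_ge0 andbT.
  by have := hA x; have := dotvv_ge0 x; rewrite Ax !linear_dotv; nra.
(* Any lower bound [-c] for the form of [W] improves to [-c/4]: with [x = (A + t) y] the equation
   gives [x'Wx = (Ay)'W(Ay) + t y'Qy], and [|A y| <= |x| / 2]. Iterating drives the bound to 0. *)
have halve c : 0 <= c -> (forall x, - c * dotv x x <= dotv x (W *m x)) ->
    forall x, - (c / 4) * dotv x x <= dotv x (W *m x).
  move=> c0 hc x; pose y := invmx (A + t%:M) *m x.
  have ex : x = A *m y + t *: y by rewrite -mul_scalar_mx -mulmxDl mulKVmx.
  have xWx : dotv x (W *m x) = dotv (A *m y) (W *m (A *m y)) + t * dotv y (Q *m y).
    rewrite -WQ !mulmxDl -scalemxAl -!mulmxA ex mulmxDr -scalemxAr !linear_dotv.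
    rewrite [dotv y (A^T *m _)]dotv_mulmxr trmxK.
    ring.
  have xAy : 4 * dotv (A *m y) (A *m y) <= dotv x x.
    have t20 : 0 < t / 4 by lra.
    have := dotvv_ge0 ((1 / 2 * t) *: y + 2 *: (A *m y)).
    have := hA y; have := dotvv_ge0 y; have := dotvv_ge0 (A *m y).
    rewrite ex !linear_dotv [dotv (A *m y) y]dotvC.
    set u := dotv y y; set v := dotv _ (A *m y); set w := dotv y _.
    move=> v0 u0 vb h.
    have : 10 * b * u <= t * t * u by rewrite ler_wpM2r // ltW.
    lra.
  rewrite xWx; have := hc (A *m y); have := Q_ge0 y; nra.
have [b' b'0 hW] := mulmx_bounded W.
have hk k x : - (b' + 1) / 4 ^+ k * dotv x x <= dotv x (W *m x).
  elim: k x => [|k IHk] x.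
    have := dotv_young x (- (W *m x)) ltr01; have := hW x.
    rewrite expr0 invr1 !linear_dotv; have := dotvv_ge0 x.
    by have := dotvv_ge0 (W *m x); lra.
  have := halve ((b' + 1) / 4 ^+ k) _ _ x; rewrite exprSr invfM mulrA !mulNr.
  apply=> [|y]; last by have := IHk y; rewrite !mulNr.
  by rewrite divr_ge0 ?exprn_ge0 //; lra.
move=> x; rewrite leNgt; apply/negP => xWx.
pose d := (b' + 1) * dotv x x / - dotv x (W *m x).
have d0 : 0 <= d by rewrite divr_ge0 // ?mulr_ge0 ?dotvv_ge0 //; lra.
(* The archimedean property supplies a [k] for which the bound [hk] contradicts [x'Wx < 0]. *)
have [k dk] : exists k, d < 4 ^+ k.
  exists (Num.bound d); apply: lt_le_trans (archi_boundP d0) _.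
  by rewrite -natrX ler_nat ltnW // ltn_expl.
have p4 : 0 < 4 ^+ k :> R by rewrite exprn_gt0.
have := hk k x; rewrite mulrAC ler_pdivrMr //; move: dk.
rewrite /d ltr_pdivrMr; last by lra.
by set c := 4 ^+ k; lra.
Qed.

Definition unobservable n s (C : 'M[R]_(s, n)) (A : 'M[R]_n) (x : 'cV[R]_n) :=
  forall k, C *m iter k (mulmx A) x = 0.

(* The solution [W] of [A'W + WA + tW = 2C'C] has the range of [P] as its kernel,
   so [W + P] is invertible, and [K = - (W + P)^-1 C'] satisfies [W K = - C'],
   which cancels the output term in the derivative of [x'Wx]. *)
Lemma observer_gain n s (A P : 'M[R]_n) (C : 'M[R]_(s, n)) (lam : R) :
  P^T = P -> P *m P = P -> P *m (A *m P) = A *m P -> C *m P = 0 ->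
  (forall x, unobservable C A x -> P *m x = x) ->
  exists (K : 'M[R]_(n, s)) (W : 'M[R]_n) (nu : R), [/\ 0 < nu, W^T = W, W *m P = 0,
    forall x, nu * dotv (x - P *m x) (x - P *m x) <= dotv x (W *m x) &
    forall x, 2 * dotv x (W *m (A *m x + K *m (C *m x)))
      <= - 2 * lam * dotv x (W *m x)].
Proof.
move=> symP PP PAP CP Pmax.
have [t0 t00 psd] := lyapunov_psd A.
(* Each summand serves one demand: [t0] semidefiniteness, [A^T] and [A] existence and symmetry of
   [W], [A *m P] the identity [W P = 0], and [lam] the decay rate. *)
pose t := t0 + norm1 A^T + norm1 A + norm1 (A *m P) + 2 * `|lam|.
have lam_norm := ler_norm lam; have lam0 := normr_ge0 lam.
have := norm1_ge0 A^T; have := norm1_ge0 A; have := norm1_ge0 (A *m P).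
move=> n1 n2 n3.
have [W WQ] : exists W, A^T *m W + W *m A + t *: W = 2 *: (C^T *m C).
  by apply: sylvester_solve; rewrite /t; lra.
have symW : W^T = W.
  apply: (@sylvester_uniq _ _ _ A^T A _ _ t); first by rewrite /t; lra.
  have := congr1 trmx WQ; rewrite !linearD !linearZ /= !trmx_mul !trmxK.
  by rewrite [W^T *m A + _]addrC => ->; rewrite WQ.
(* As [A P = P A P] and [C P = 0], multiplying the equation by [P] on the right shows that [W P]
   solves a homogeneous Sylvester equation. *)
have WP : W *m P = 0.
  apply: (@sylvester_inj _ _ _ A^T (A *m P) _ t); first by rewrite /t; lra.
  rewrite -[W *m P *m _]mulmxA PAP !mulmxA scalemxAl -!mulmxDl WQ.
  by rewrite -scalemxAl -mulmxA CP mulmx0 scaler0.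
have xQx x : 2 * dotv x (W *m (A *m x)) + t * dotv x (W *m x)
    = 2 * dotv (C *m x) (C *m x).
  have := congr1 (fun M => dotv x (M *m x)) WQ.
  rewrite !mulmxDl -!scalemxAl -!mulmxA !linear_dotv [dotv x (C^T *m _)]dotv_mulmxr trmxK.
  by move <-; rewrite [dotv x (A^T *m _)]dotv_mulmxr trmxK dotvC dotv_mulmxr symW; ring.
have W_ge0 x : 0 <= dotv x (W *m x).
  apply: psd WQ _ x; first by rewrite /t; lra.
  move=> x; rewrite -scalemxAl -mulmxA dotvZr dotv_mulmxr trmxK.
  by rewrite mulr_ge0 ?dotvv_ge0.
have xPx x : dotv x (P *m x) = dotv (P *m x) (P *m x).
  by rewrite [RHS]dotv_mulmxr symP mulmxA PP dotvC.
(* The kernel of [W] lies in the unobservable subspace: for [W y = 0] the form of the equation gives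
   [C y = 0], and the equation applied to [y] then gives [W A y = 0], so the kernel is
   [A]-invariant. *)
have kerW x : dotv x (W *m x) = 0 -> P *m x = x.
  move=> x0; apply: Pmax => k.
  have : W *m iter k (mulmx A) x = 0.
    elim: k => [|k IHk] /=; first exact: psd_ker.
    set y := iter k _ x in IHk *.
    have Cy : C *m y = 0.
      apply: dotvv_eq0; have := xQx y.
      by rewrite IHk dotv0r dotv_mulmxr symW IHk dotv0l; lra.
    have := congr1 (mulmx^~ y) WQ; rewrite !mulmxDl -!scalemxAl -!mulmxA IHk Cy.
    by rewrite !mulmx0 !scaler0 addr0 add0r.
  set y := iter k _ x => Wy.
  by apply: dotvv_eq0; have := xQx y; rewrite Wy dotv0r dotv_mulmxr symW Wy dotv0l; lra.
have M0 x : dotv x ((W + P) *m x) = 0 -> x = 0.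
  rewrite mulmxDl dotvDr => h; have := W_ge0 x; have := dotvv_ge0 (P *m x).
  rewrite -xPx => h1 h2; have Px : P *m x = 0 by apply: dotvv_eq0; rewrite -xPx; lra.
  by rewrite -(kerW x) //; lra.
have symM : (W + P)^T = W + P by rewrite linearD /= symW symP.
have M_ge0 x : 0 <= dotv x ((W + P) *m x).
  by rewrite mulmxDl dotvDr addr_ge0 // xPx dotvv_ge0.
have [nu nu0 hnu] := pd_lower_bound symM M_ge0 M0.
have Mu := pd_unitmx M0.
have PW : P *m W = 0 by rewrite -[LHS]trmxK trmx_mul symW symP WP trmx0.
pose K := - (invmx (W + P) *m C^T).
(* From [P (W + P) = P] one gets [P (W + P)^-1 = P], and [P C' = 0]. Hence
   [W K = (W + P) K = - C']. *)
have PK : P *m K = 0.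
  have PM : P *m invmx (W + P) = P.
    have e : P *m (W + P) = P by rewrite mulmxDr PW PP add0r.
    by rewrite -{1}e mulmxK.
  by rewrite /K mulmxN mulmxA PM -symP -trmx_mul CP trmx0 oppr0.
have WK : W *m K = - C^T.
  by rewrite -[LHS]addr0 -PK -mulmxDl /K mulmxN mulKVmx.
exists K, W, nu; split=> // x.
  have := hnu (x - P *m x); rewrite mulmxDl [P *m (_ - _)]mulmxBr !mulmxA PP subrr addr0.
  rewrite mulmxBr !mulmxA WP mul0mx subr0 [dotv (_ - _) (W *m x)]dotvBl.
  by rewrite [dotv (P *m x) (W *m x)]dotv_mulmxr symW mulmxA WP mul0mx dotv0l subr0.
(* The output term contributes [-2 |C x|^2], which cancels the right-hand side [2 C'C] of the
   equation and leaves [- t x'Wx]. *)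
rewrite mulmxDr !linear_dotv [W *m (K *m _)]mulmxA WK mulNmx dotvNr.
rewrite [dotv x (C^T *m _)]dotv_mulmxr trmxK.
have tl : 2 * lam <= t by rewrite /t; lra.
have := ler_wpM2r (W_ge0 x) tl; have := xQx x; lra.
Qed.

End Observer.

(** * Coercivity of the coupling on the product of the unobservable subspaces *)

Section Coupling.
Variables (R : realFieldType) (m n : nat).
Implicit Types (S : 'I_m -> 'I_m -> R) (w : 'I_m -> 'cV[R]_n).

Definition stochastic2 S := [/\ forall i j, 0 <= S i j,
  forall i, \sum_j S i j = 1 & forall j, \sum_i S i j = 1].

Definition sqdist w i j := dotv (w i - w j) (w i - w j).

(** Expanding the squares, unit row sums collapse the [|w_i|^2] terms and unit column sums the
    [|w_j|^2] terms. *)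
Lemma dirichlet_form S w : stochastic2 S ->
  2 * \sum_i dotv (w i) (w i - \sum_j S i j *: w j)
    = \sum_i \sum_j S i j * sqdist w i j.
Proof.
move=> [_ row1 col1].
have -> : \sum_i \sum_j S i j * sqdist w i j =
    \sum_i \sum_j S i j * dotv (w i) (w i)
    + \sum_i \sum_j S i j * dotv (w j) (w j)
    - 2 * \sum_i \sum_j S i j * dotv (w i) (w j).
  rewrite mulr_sumr -big_split -sumrB; apply: eq_bigr => i _ /=.
  rewrite mulr_sumr -big_split -sumrB; apply: eq_bigr => j _ /=.
  by rewrite /sqdist !linear_dotv [dotv (w j) (w i)]dotvC; ring.
rewrite [X in _ = _ + X - _]exchange_big /=.
have h1 : \sum_i \sum_j S i j * dotv (w i) (w i) = \sum_i dotv (w i) (w i).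
  by apply: eq_bigr => i _; rewrite -mulr_suml row1 mul1r.
have h2 : \sum_j \sum_i S i j * dotv (w j) (w j) = \sum_i dotv (w i) (w i).
  by apply: eq_bigr => i _; rewrite -mulr_suml col1 mul1r.
have -> : \sum_i dotv (w i) (w i - \sum_j S i j *: w j) =
   \sum_i dotv (w i) (w i) - \sum_i \sum_j S i j * dotv (w i) (w j).
  rewrite -sumrB; apply: eq_bigr => i _; rewrite dotvBr dotv_sumr.
  by congr (_ - _); apply: eq_bigr => j _; rewrite dotvZr.
by rewrite h1 h2; ring.
Qed.

(** One arc costs at most the form divided by its weight, and [|u - v|^2 <= 2 |u|^2 + 2 |v|^2]
    chains the arcs of a path. Summing the constants over all pairs makes them uniform. *)
Lemma sqdist_connect S : stochastic2 S ->
  (forall i j, connect (fun a b => 0 < S b a) i j) ->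
  exists2 c, 0 < c &
    forall w i j, sqdist w i j <= c * \sum_i \sum_j S i j * sqdist w i j.
Proof.
move=> [S0 _ _] conn.
have D0 w : 0 <= \sum_i \sum_j S i j * sqdist w i j.
  by rewrite sumr_ge0 // => i _; rewrite sumr_ge0 // => j _; rewrite mulr_ge0 ?dotvv_ge0.
have step w i j : S i j * sqdist w i j <= \sum_i \sum_j S i j * sqdist w i j.
  rewrite (bigD1 i) //= (bigD1 j) //= -addrA lerDl addr_ge0 //.
    by rewrite sumr_ge0 // => k _; rewrite mulr_ge0 ?dotvv_ge0.
  by rewrite sumr_ge0 // => k _; rewrite sumr_ge0 // => l _; rewrite mulr_ge0 ?dotvv_ge0.
have pair (ij : 'I_m * 'I_m) : exists c, 0 <= c /\
    forall w, sqdist w ij.1 ij.2 <= c * \sum_i \sum_j S i j * sqdist w i j.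
  case: ij => i j /=; have /connectP[p] := conn i j.
  elim: p i => [|k p IHp] i /=.
    by move=> _ ->; exists 0; split=> // w; rewrite /sqdist subrr dotv0r mul0r.
  move=> /andP[Ski /IHp{}IHp] /IHp [c [c0 hc]].
  exists (2 * (S k i)^-1 + 2 * c); split=> [|w].
    by rewrite addr_ge0 ?mulr_ge0 // invr_ge0 ltW.
  have := hc w; have := step w k i.
  rewrite -(ler_pM2l (x := (S k i)^-1)) ?invr_gt0 // mulrA mulVf ?gt_eqF // mul1r.
  set D := \sum_i _.
  have := dotvv_ge0 (w k - w i + (w k - w j)).
  have -> : sqdist w i j = dotv (w k - w j - (w k - w i)) (w k - w j - (w k - w i)).
    have e : w i - w j = w k - w j - (w k - w i).
      by rewrite opprB [RHS]addrC addrA subrK.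
    by rewrite /sqdist e.
  rewrite /sqdist; move: (w k - w j) (w k - w i) => u v.
  by rewrite !linear_dotv [dotv v u]dotvC mulrDl -!mulrA; lra.
have [c hc] := fin_all_exists pair.
exists (1 + \sum_ij c ij).
  by rewrite ltr_wpDr // sumr_ge0 // => ij _; case: (hc ij).
move=> w i j; have [c0 /(_ w) /= h] := hc (i, j); apply: le_trans h _.
rewrite ler_wpM2r // (bigD1 (i, j)) //= addrCA lerDl addr_ge0 // sumr_ge0 // => ij _.
by case: (hc ij).
Qed.

Definition orth_proj (P : 'M[R]_n) := P^T = P /\ P *m P = P.

Lemma orth_proj_dotv P (x y : 'cV_n) : orth_proj P ->
  dotv x (P *m y) = dotv (P *m x) (P *m y).
Proof. by move=> [symP PP]; rewrite [RHS]dotv_mulmxr symP mulmxA PP dotv_mulmxr symP. Qed.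

Lemma orth_proj_pythagoras P (x : 'cV_n) : orth_proj P ->
  dotv x x = dotv (P *m x) (P *m x) + dotv (x - P *m x) (x - P *m x).
Proof.
move=> projP; have e := orth_proj_dotv x x projP.
by rewrite !linear_dotv [dotv (P *m x) x]dotvC e; ring.
Qed.

Lemma coupling_bound S (P : 'I_m -> 'M[R]_n) : stochastic2 S ->
  (forall i j, connect (fun a b => 0 < S b a) i j) ->
  (forall i, orth_proj (P i)) ->
  (forall x : 'cV_n, (forall i, P i *m x = x) -> x = 0) ->
  exists2 mu, 0 < mu & forall w, (forall i, P i *m w i = w i) ->
    mu * \sum_i dotv (w i) (w i)
      <= \sum_i dotv (w i) (w i - \sum_j S i j *: w j).
Proof.
move=> Sds conn projP Pcap; have [c c0 hc] := sqdist_connect Sds conn.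
(* The form of [M] is the sum of the squared distances of [x] to the subspaces; it vanishes only on
   their intersection, hence is bounded below by [nu |x|^2]. *)
pose M := \sum_i (1%:M - P i).
have symM : M^T = M.
  rewrite /M linear_sum; apply: eq_bigr => i _ /=.
  by have [symP _] := projP i; rewrite linearB /= trmx1 symP.
have MxE x : M *m x = \sum_i (x - P i *m x).
  by rewrite mulmx_suml; apply: eq_bigr => i _; rewrite mulmxBl mul1mx.
have xMx x : dotv x (M *m x) = \sum_i dotv (x - P i *m x) (x - P i *m x).
  rewrite MxE dotv_sumr; apply: eq_bigr => i _.
  have := orth_proj_pythagoras x (projP i).
  by rewrite [dotv x (_ - _)]dotvBr (orth_proj_dotv x x (projP i)); lra.
have [||nu nu0 hnu] := pd_lower_bound symM.
- by move=> x; rewrite xMx sumr_ge0 // => i _; exact: dotvv_ge0.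
- move=> x /eqP; rewrite xMx psumr_eq0; last by move=> i _; exact: dotvv_ge0.
  move=> /allP h; apply: Pcap => i; apply/esym/eqP; rewrite -subr_eq0.
  by apply/eqP/dotvv_eq0/eqP; exact: (h i (mem_index_enum i)).
pose k := c * m%:R * m%:R + 1.
have k0 : 0 < k by rewrite /k ltr_wpDl // !mulr_ge0 // ltW.
exists (nu / (2 * k)) => [|w wP]; first by rewrite divr_gt0 // mulr_gt0.
have := dirichlet_form w Sds; set D := \sum_i \sum_j _ => hD.
have D0 : 0 <= D.
  case: Sds => S0 _ _; rewrite sumr_ge0 // => i _; rewrite sumr_ge0 // => j _.
  by rewrite mulr_ge0 ?dotvv_ge0.
have wi i : nu * dotv (w i) (w i) <= m%:R * (c * D).
  apply: le_trans (hnu _) _; rewrite xMx.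
  have -> : m%:R * (c * D) = \sum_(j < m) c * D by rewrite sumr_const card_ord mulr_natl.
  apply: ler_sum => j _; apply: le_trans (hc w i j).
  (* As [P_j] fixes [w_j], the distance from [w_i] to the range of [P_j] is at most
     [|w_i - w_j|]. *)
  have e : w i - w j - P j *m (w i - w j) = w i - P j *m w i.
    by rewrite mulmxBr wP opprB addrA subrK.
  by rewrite /sqdist (orth_proj_pythagoras (w i - w j) (projP j)) e lerDr dotvv_ge0.
have sw : nu * \sum_i dotv (w i) (w i) <= k * D.
  rewrite mulr_sumr; apply: (@le_trans _ _ (\sum_(i < m) m%:R * (c * D))).
    by apply: ler_sum => i _; exact: wi.
  rewrite sumr_const card_ord -mulr_natl /k mulrDl mul1r.
  rewrite [X in X <= _](_ : _ = c * m%:R * m%:R * D); first by rewrite lerDl.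
  by ring.
rewrite mulrAC ler_pdivrMr; last by rewrite mulr_gt0.
by rewrite mulrA [_ * 2]mulrC hD [D * k]mulrC.
Qed.

End Coupling.

(** * A quadratic Lyapunov function common to all the graphs *)

Section Design.
Variable R : archiRealFieldType.

(** Finiteness of the index set enters here: the coercivity constants of the individual graphs have
    a positive minimum. *)
Lemma uniform_lower_bound (T : Type) (Q : T -> R -> Prop) (l : list T) :
  (forall p mu mu', mu' <= mu -> Q p mu -> Q p mu') ->
  (forall p, exists2 mu, 0 < mu & Q p mu) ->
  exists2 mu, 0 < mu & forall p, List.In p l -> Q p mu.
Proof.
move=> Qmono Qex; elim: l => [|p l [mu mu0 hmu]]; first by exists 1.
have [mu' mu'0 hmu'] := Qex p; exists (Num.min mu mu').
  by rewrite lt_min mu0.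
move=> q [<-|ql]; first by apply: Qmono hmu'; rewrite ge_min lexx orbT.
by apply: Qmono (hmu _ ql); rewrite ge_min lexx.
Qed.

(* With [w_i = P_i e_i] and [z_i = e_i - w_i], the component [z_i] is autonomous
   and [W_i] is a Lyapunov function for it of rate [lam + 1]; the coupling makes
   [w] decay at rate [g mu] up to a forcing by [z], which the weight [Gam_i] of
   [W_i] absorbs. *)
Lemma observer_lyapunov (m n : nat) (s : 'I_m -> nat) (A : 'M[R]_n)
    (C : forall i, 'M[R]_(s i, n)) (P : 'I_m -> 'M[R]_n)
    (T : Type) (S : T -> 'I_m -> 'I_m -> R) (l : list T) (lam : R) :
  0 < lam -> (forall i, orth_proj (P i)) ->
  (forall i, P i *m (A *m P i) = A *m P i) -> (forall i, C i *m P i = 0) ->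
  (forall i x, unobservable (C i) A x -> P i *m x = x) ->
  (forall x : 'cV_n, (forall i, P i *m x = x) -> x = 0) ->
  (forall p, List.In p l) -> (forall p, stochastic2 (S p)) ->
  (forall p i j, connect (fun a b => 0 < S p b a) i j) ->
  exists K : forall i, 'M[R]_(n, s i), exists2 g0, 0 < g0 &
  forall g, g0 <= g -> exists (H : 'I_m -> 'M[R]_n) (h : R),
  [/\ 0 < h, forall i, (H i)^T = H i,
    forall i x, dotv x x <= dotv x (H i *m x) <= h * dotv x x &
    forall p (e : 'I_m -> 'cV[R]_n),
      2 * \sum_i dotv (e i) (H i *m (A *m e i + K i *m (C i *m e i)
            - g *: (P i *m (e i - \sum_j S p i j *: e j))))
      <= - 2 * lam * \sum_i dotv (e i) (H i *m e i)].
Proof.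
move=> lam0 projP PAP CP Pmax Pcap lT Sds Sconn.
have agent i : exists KWnu : 'M[R]_(n, s i) * 'M[R]_n * R,
    let: (K, W, nu) := KWnu in [/\ 0 < nu, W^T = W, W *m P i = 0,
    forall x, nu * dotv (x - P i *m x) (x - P i *m x) <= dotv x (W *m x) &
    forall x, 2 * dotv x (W *m (A *m x + K *m (C i *m x)))
      <= - 2 * (lam + 1) * dotv x (W *m x)].
  have [symP PP] := projP i.
  have [K [W [nu h]]] := observer_gain (lam + 1) symP PP (PAP i) (CP i) (@Pmax i).
  by exists (K, W, nu).
have [KWnu hagent] := fin_all_exists agent => {agent}.
pose K i := (KWnu i).1.1; pose W i := (KWnu i).1.2; pose nu i := (KWnu i).2.
have {hagent}hagent i : [/\ 0 < nu i, (W i)^T = W i, W i *m P i = 0,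
    forall x, nu i * dotv (x - P i *m x) (x - P i *m x) <= dotv x (W i *m x) &
    forall x, 2 * dotv x (W i *m (A *m x + K i *m (C i *m x)))
      <= - 2 * (lam + 1) * dotv x (W i *m x)].
  by have := hagent i; rewrite /nu /W /K; case: (KWnu i) => [[]].
have [mu mu0 hmu] : exists2 mu, 0 < mu & forall p, List.In p l ->
    forall w, (forall i, P i *m w i = w i) ->
    mu * \sum_i dotv (w i) (w i)
      <= \sum_i dotv (w i) (w i - \sum_j S p i j *: w j).
  apply: uniform_lower_bound => [p mu mu' le_mu h w wP|p].
    apply: le_trans (h w wP); rewrite ler_wpM2r // sumr_ge0 // => i _.
    exact: dotvv_ge0.
  exact: coupling_bound.
have [a a0 hA] := mulmx_bounded A.
have [b b0 hb] := fin_all_exists2 (fun i => mulmx_bounded (A + K i *m C i)).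
exists K, ((2 + a + 2 * lam) / mu) => [|g]; first by rewrite divr_gt0 //; lra.
rewrite ler_pdivrMr // => hg.
have g0 : 0 < g by rewrite -(pmulr_lgt0 _ mu0); lra.
(* The term [b i] pays for the forcing of [w_i] by [z_i] through [A + K_i C_i], [g / mu] for the
   forcing through the coupling, and 1 makes the form of [H i] dominate [|x|^2]. *)
pose Gam i := (b i + g / mu + 1) / nu i.
have gmu0 : 0 < g / mu by rewrite divr_gt0.
have Gam0 i : 0 < Gam i.
  by case: (hagent i) => nu0 _ _ _ _; rewrite divr_gt0 //; have := b0 i; lra.
pose H i := P i + Gam i *: W i.
have symH i : (H i)^T = H i.
  have [symP _] := projP i; have [_ symW _ _ _] := hagent i.
  by rewrite /H linearD linearZ /= symP symW.
have Wge i x : (b i + g / mu + 1) * dotv (x - P i *m x) (x - P i *m x)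
    <= Gam i * dotv x (W i *m x).
  have [nu0 _ _ hW _] := hagent i.
  rewrite /Gam mulrAC ler_pdivlMr // -mulrA ler_wpM2l //; last by rewrite mulrC.
  by have := b0 i; lra.
have HE i x : dotv x (H i *m x)
    = dotv (P i *m x) (P i *m x) + Gam i * dotv x (W i *m x).
  by rewrite /H mulmxDl -scalemxAl dotvDr dotvZr (orth_proj_dotv x x (projP i)).
have [d d0 hd] := fin_all_exists2 (fun i => mulmx_bounded (H i)).
have sd0 : 0 <= \sum_i d i by rewrite sumr_ge0 // => i _; rewrite ltW.
exists H, (1 + \sum_i d i); split=> // [|i x|p e]; first by lra.
  apply/andP; split.
    rewrite HE (orth_proj_pythagoras x (projP i)) lerD2l.
    apply: le_trans (Wge i x); rewrite ler_peMl ?dotvv_ge0 //.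
    by have := b0 i; lra.
  have : (1 + d i) * dotv x x <= (1 + \sum_j d j) * dotv x x.
    rewrite ler_wpM2r ?dotvv_ge0 // lerD2l (bigD1 i) //= lerDl.
    by rewrite sumr_ge0 // => j _; rewrite ltW.
  have := dotv_young x (H i *m x) ltr01; have := hd i x; rewrite invr1.
  have := d0 i; have := dotvv_ge0 x; nra.
pose w i := P i *m e i; pose z i := e i - w i.
have wP i : P i *m w i = w i by have [_ PP] := projP i; rewrite /w mulmxA PP.
have ewz i : e i = w i + z i by rewrite /z addrC subrK.
have wz i : dotv (w i) (z i) = 0.
  rewrite /z dotvBr /w (dotvC _ (e i)) (orth_proj_dotv _ _ (projP i)).
  by rewrite subrr.
pose B i (x : 'cV[R]_n) := A *m x + K i *m (C i *m x).
have Bw i : B i (e i) = A *m w i + (A + K i *m C i) *m z i.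
  rewrite /B mulmxDl -mulmxA {1}ewz mulmxDr -addrA; congr (_ + (_ + K i *m _)).
  by rewrite /z mulmxBr /w [C i *m (P i *m _)]mulmxA CP mul0mx subr0.
pose y i := e i - \sum_j S p i j *: e j.
have split_i i : 2 * dotv (e i) (H i *m (B i (e i) - g *: (P i *m y i)))
    <= (2 + a) * dotv (w i) (w i) - 2 * g * dotv (w i) (y i)
       - 2 * lam * (Gam i * dotv (e i) (W i *m e i)) - g / mu * dotv (z i) (z i).
  have [_ symW WP _ hW] := hagent i; have [symP PP] := projP i.
  have hWe : 2 * (Gam i * dotv (e i) (W i *m B i (e i)))
      <= - 2 * (lam + 1) * (Gam i * dotv (e i) (W i *m e i)).
    by rewrite mulrCA [X in _ <= X]mulrCA ler_wpM2l ?hW // ltW.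
  have hWge := Wge i (e i); rewrite -/(w i) -/(z i) in hWge.
  (* The coupling term lies in the range of [P_i], so [W_i P_i = 0] removes it from the [W_i] part,
     while [P_i w_i = w_i] drops the projection in the other part. *)
  have -> : dotv (e i) (H i *m (B i (e i) - g *: (P i *m y i)))
      = dotv (w i) (B i (e i)) - g * dotv (w i) (y i)
        + Gam i * dotv (e i) (W i *m B i (e i)).
    rewrite /H mulmxDl -scalemxAl dotvDr dotvZr; congr (_ + _ * _).
      rewrite dotv_mulmxr symP -/(w i) dotvBr dotvZr; congr (_ - _ * _).
      by rewrite dotv_mulmxr symP wP.
    by rewrite mulmxBr -scalemxAr mulmxA WP mul0mx scaler0 subr0.
  have := dotv_young (w i) (A *m w i) ltr01; have := hA (w i).
  have := dotv_young (w i) ((A + K i *m C i) *m z i) ltr01; have := hb i (z i).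
  rewrite invr1 !mul1r; have := dotvv_ge0 (z i).
  have := mulr_ge0 (ltW (b0 i)) (dotvv_ge0 (z i)).
  have := mulr_ge0 (ltW gmu0) (dotvv_ge0 (z i)).
  have : dotv (w i) (B i (e i))
      = dotv (w i) (A *m w i) + dotv (w i) ((A + K i *m C i) *m z i).
    by rewrite Bw dotvDr.
  lra.
(* Twice the Dirichlet part gives [2 mu |w|^2]. Young's inequality with weight [mu] on each
   [S_ij w_i.z_j] gives back one [mu |w|^2] and costs [|z|^2 / mu], by the unit row and column
   sums. *)
have cross : mu * (\sum_i dotv (w i) (w i)) - mu^-1 * (\sum_i dotv (z i) (z i))
    <= 2 * \sum_i dotv (w i) (y i).
  have -> : \sum_i dotv (w i) (y i)
      = \sum_i dotv (w i) (w i - \sum_j S p i j *: w j)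
        - \sum_i \sum_j S p i j * dotv (w i) (z j).
    rewrite -sumrB; apply: eq_bigr => i _; rewrite /y !dotvBr {1}ewz dotvDr wz addr0.
    rewrite -addrA; congr (_ + _); rewrite -opprD; congr (- _).
    rewrite !dotv_sumr -big_split; apply: eq_bigr => j _ /=.
    by rewrite ewz !dotvZr dotvDr mulrDr.
  have [S0 row1 col1] := Sds p.
  have : 2 * (\sum_i \sum_j S p i j * dotv (w i) (z j))
      <= mu * (\sum_i dotv (w i) (w i)) + mu^-1 * (\sum_i dotv (z i) (z i)).
    have -> : \sum_i dotv (w i) (w i) = \sum_i \sum_j S p i j * dotv (w i) (w i).
      by apply: eq_bigr => i _; rewrite -mulr_suml row1 mul1r.
    have -> : \sum_i dotv (z i) (z i) = \sum_i \sum_j S p i j * dotv (z j) (z j).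
      by rewrite exchange_big; apply: eq_bigr => i _; rewrite -mulr_suml col1 mul1r.
    rewrite !mulr_sumr -big_split; apply: ler_sum => i _ /=.
    rewrite !mulr_sumr -big_split; apply: ler_sum => j _ /=.
    rewrite mulrCA [mu * _]mulrCA [mu^-1 * _]mulrCA -mulrDr ler_wpM2l //.
    exact: dotv_young.
  have := hmu p (lT p) w wP; lra.
rewrite mulr_sumr; apply: le_trans (ler_sum _ (fun i _ => split_i i)) _.
under [X in _ <= _ * X]eq_bigr => i _ do rewrite HE -/(w i).
rewrite !sumrB big_split /= -!mulr_sumr.
(* In the sum the [z] terms [g / mu] cancel, and [g mu >= 2 + a + 2 lam] leaves rate [2 lam] for
   [w]. *)
have := ler_wpM2l (ltW g0) cross.
have : (2 + a + 2 * lam) * (\sum_i dotv (w i) (w i))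
    <= g * mu * (\sum_i dotv (w i) (w i)).
  by rewrite ler_wpM2r // sumr_ge0 // => i _; exact: dotvv_ge0.
set sw := \sum_i _; set sz := \sum_i _; set sy := \sum_i _; set sq := \sum_i _.
lra.
Qed.

End Design.

End ObserverDesign.

(** * Error dynamics in coordinates *)

Module ErrorDynamics.
Import all_boot all_order all_algebra archimedean Rstruct.
Import ObserverDesign.
Set Implicit Arguments.
Unset Strict Implicit.
Unset Printing Implicit Defensive.
Import Order.TTheory GRing.Theory Num.Theory.
Local Open Scope ring_scope.

(** * Translation between functions on [nat] and matrices *)

Section Coordinates.

Definition colv n (v : nat -> R) : 'cV[R]_n := \col_i v i.
Definition mxof p n (M : nat -> nat -> R) : 'M[R]_(p, n) := \matrix_(i, j) M i j.
(** Indices outside the dimension get the default value 0, here and in [funmx]. *)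
Definition seqv n (u : 'cV[R]_n) (k : nat) : R := oapp (fun i => u i 0) 0 (insub k).
Definition funmx p n (M : 'M[R]_(p, n)) (i k : nat) : R :=
  oapp (fun i' => oapp (fun k' => M i' k') 0 (insub k)) 0 (insub i).

Lemma seqvK n (u : 'cV[R]_n) : colv n (seqv u) = u.
Proof. by apply/colP => i; rewrite mxE /seqv valK. Qed.

Lemma funmxK p n (M : 'M[R]_(p, n)) : mxof p n (funmx M) = M.
Proof. by apply/matrixP => i k; rewrite mxE /funmx !valK. Qed.

Lemma rsumE k f : rsum k f = \sum_(i < k) f i.
Proof. by elim: k => [|k IHk] /=; rewrite ?big_ord0 // big_ord_recr /= IHk. Qed.

Lemma dotE n u v : dot n u v = dotv (colv n u) (colv n v).
Proof. by rewrite /dot rsumE dotvE; apply: eq_bigr => i _; rewrite !mxE. Qed.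

Lemma colvB n u v : colv n (fun k => u k - v k) = colv n u - colv n v.
Proof. by apply/colP => i; rewrite !mxE. Qed.

Lemma colv_mv p n M v : colv p (mv n M v) = mxof p n M *m colv n v.
Proof.
apply/colP => i; rewrite !mxE /mv rsumE.
by apply: eq_bigr => j _; rewrite !mxE.
Qed.

Lemma colv_eq0 n v : colv n v = 0 <-> forall k, (k < n)%N -> v k = 0.
Proof.
split=> [/colP v0 k kn|v0]; first by have := v0 (Ordinal kn); rewrite !mxE.
by apply/colP => i; rewrite !mxE v0.
Qed.

Lemma unobsE n s C A v : unobs n s C A v <->
  unobservable (mxof s n C) (mxof n n A) (colv n v).
Proof.
have iterE k : iter k (mulmx (mxof n n A)) (colv n v)
    = colv n (Nat.iter k (mv n A) v).
  by elim: k => //= k ->; rewrite colv_mv.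
split=> h k.
  by rewrite iterE -colv_mv; apply/colv_eq0 => r rs; apply: h; apply/ssrnat.ltP.
by move=> r /ssrnat.ltP rs; have := h k; rewrite iterE -colv_mv => /colv_eq0 /(_ r rs).
Qed.

Lemma unobservableB n s (C : 'M[R]_(s, n)) (A : 'M[R]_n) x y :
  unobservable C A x -> unobservable C A y -> unobservable C A (x - y).
Proof.
move=> hx hy k; have -> : iter k (mulmx A) (x - y)
    = iter k (mulmx A) x - iter k (mulmx A) y.
  by elim: k => //= k ->; rewrite mulmxBr.
by rewrite mulmxBr hx hy subrr.
Qed.

Lemma unobservableM n s (C : 'M[R]_(s, n)) (A : 'M[R]_n) x :
  unobservable C A x -> unobservable C A (A *m x).
Proof. by move=> hx k; rewrite -iterSr; exact: hx. Qed.

Lemma matrix_ext p n (M N : 'M[R]_(p, n)) :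
  (forall x : 'cV_n, M *m x = N *m x) -> M = N.
Proof.
move=> h; apply/matrixP => i j; have := h (delta_mx j 0).
by rewrite -!colE => /colP /(_ i); rewrite !mxE.
Qed.

Lemma dotv_ext n (u v : 'cV[R]_n) : (forall x, dotv x u = dotv x v) -> u = v.
Proof.
move=> h; apply/eqP; rewrite -subr_eq0; apply/eqP/dotvv_eq0.
by rewrite [X in X = _]dotvBr h subrr.
Qed.

(** Orthogonality says [x.(Py) = (Px).(Py)], that is [P'P = P], whence symmetry. The other
    identities hold because [P] fixes the subspace, which is [A]-invariant and inside the kernel of
    [C]. *)
Lemma unobs_projection n s C A Q : is_orth_proj n (unobs n s C A) Q ->
  let P := mxof n n Q in let C' := mxof s n C in let A' := mxof n n A in
  [/\ orth_proj P, P *m (A' *m P) = A' *m P, C' *m P = 0,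
    forall x, unobservable C' A' (P *m x) &
    forall x, unobservable C' A' x -> P *m x = x].
Proof.
move=> [Vproj Vorth] P C' A'.
have VP x : unobservable C' A' (P *m x).
  by rewrite -(seqvK x) -colv_mv; apply/unobsE.
have orthP x y : unobservable C' A' y -> dotv (x - P *m x) y = 0.
  rewrite -(seqvK x) -(seqvK y) -colv_mv -colvB -dotE => /unobsE.
  exact: Vorth.
have fixP x : unobservable C' A' x -> P *m x = x.
  move=> Vx; apply/esym/eqP; rewrite -subr_eq0; apply/eqP/dotvv_eq0.
  by apply: orthP; apply: unobservableB.
have PtP : P^T *m P = P.
  apply: matrix_ext => y; apply: dotv_ext => x; apply/esym/eqP.
  rewrite -mulmxA [dotv x (P^T *m _)]dotv_mulmxr trmxK -subr_eq0 -dotvBl.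
  by apply/eqP; exact: orthP.
split=> //; first split.
- by rewrite -{1}PtP trmx_mul trmxK.
- by apply: matrix_ext => x; rewrite -mulmxA fixP.
- by apply: matrix_ext => x; rewrite -!mulmxA fixP //; exact: unobservableM.
- by apply: matrix_ext => x; rewrite -mulmxA mul0mx; exact: (VP x 0%N).
Qed.

Lemma cnt_gt0 k (b : nat -> bool) j : (j < k)%N -> b j -> (0 < cnt k b)%N.
Proof.
elim: k => // k IHk; rewrite ltnS leq_eqVlt /= => /orP[/eqP <- ->|jk bj].
  by rewrite plusE addn1.
by rewrite plusE addn_gt0 IHk.
Qed.

Lemma Smat_gt0 m (G : nat -> nat -> bool) i j : (j < m)%N -> G j i -> 0 < Smat m G i j.
Proof.
move=> jm Gji; rewrite /Smat Gji; apply/RltP/Rinv_0_lt_compat/lt_0_INR/ssrnat.ltP.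
exact: cnt_gt0 jm Gji.
Qed.

Lemma Smat_stochastic2 m G : doubly_stochastic m (Smat m G) ->
  stochastic2 (fun i j : 'I_m => Smat m G i j).
Proof.
move=> [S0 [row1 col1]]; split=> [i j|i|j].
- by apply/RleP/S0; apply/ssrnat.ltP.
- by rewrite -rsumE row1 //; apply/ssrnat.ltP.
- by rewrite -(rsumE m (fun i => Smat m G i j)) col1 //; apply/ssrnat.ltP.
Qed.

Lemma Smat_connect m G : strongly_connected m G ->
  forall i j : 'I_m, connect (fun a b : 'I_m => 0 < Smat m G b a) i j.
Proof.
move=> conn i j.
(* The closure that peels off the first arc suits induction; an arc from [a] to [b] is the entry
   [S b a], as [S] is built on the transposed adjacency matrix. *)
have rt1n a b : clos_refl_trans_1n nat (graph_edge m G) a b ->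
    forall i j : 'I_m, i = a :> nat -> j = b :> nat ->
    connect (fun a b : 'I_m => 0 < Smat m G b a) i j.
  elim=> {a b} [a i' j' <- /val_inj -> //|a b c [_ [bm Gab]] _ IH i' j' ia jc].
  move/ssrnat.ltP in bm; apply: connect_trans (IH (Ordinal bm) j' erefl jc).
  by apply: connect1; apply: Smat_gt0 (ltn_ord _) _; rewrite /= ia.
by apply: rt1n (clos_rt_rt1n _ _ _ _ (conn i j _ _)) _ _ _ _ => //; apply/ssrnat.ltP.
Qed.

End Coordinates.

(** * Exponential decay along right-differentiable curves *)

Section Decay.

Definition vrderiv n (v : R -> 'cV[R]_n) t (d : 'cV[R]_n) :=
  forall k, rderiv (fun u => v u k 0) t (d k 0).

Definition vcontinuous n (v : R -> 'cV[R]_n) t :=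
  forall k, continuity_pt (fun u => v u k 0) t.

Lemma rderiv_sum (I : Type) (r : seq I) (F : I -> R -> R) l t :
  (forall i, rderiv (F i) t (l i)) ->
  rderiv (fun u => \sum_(i <- r) F i u) t (\sum_(i <- r) l i).
Proof.
move=> Fl; elim: r => [|i r IHr].
  by rewrite big_nil; apply: rderiv_ext (rderiv_const 0 t) => u; rewrite big_nil.
rewrite big_cons; apply: rderiv_ext (rderiv_plus _ _ _ _ _ (Fl i) IHr) => u.
by rewrite big_cons.
Qed.

Lemma continuity_pt_ext f g t : f =1 g -> continuity_pt f t -> continuity_pt g t.
Proof.
move=> fg cf eps eps0; have [d [d0 hd]] := cf eps eps0.
by exists d; split=> // x; rewrite -!fg; exact: hd.
Qed.

Lemma continuity_pt_sum (I : Type) (r : seq I) (F : I -> R -> R) t :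
  (forall i, continuity_pt (F i) t) ->
  continuity_pt (fun u => \sum_(i <- r) F i u) t.
Proof.
move=> cF; elim: r => [|i r IHr].
  apply: (@continuity_pt_ext (fun=> 0)) => [u|]; first by rewrite big_nil.
  exact: continuity_pt_const.
apply: (continuity_pt_ext _ (continuity_pt_plus _ _ _ (cF i) IHr)) => u.
by rewrite big_cons.
Qed.

Lemma vrderiv_dotv n (v w : R -> 'cV[R]_n) t a b : vrderiv v t a -> vrderiv w t b ->
  rderiv (fun u => dotv (v u) (w u)) t (dotv a (w t) + dotv (v t) b).
Proof.
move=> va wb; rewrite !dotvE -big_split.
apply: (rderiv_ext (fun u => \sum_i v u i 0 * w u i 0)) => [u|]; first by rewrite dotvE.
by apply: rderiv_sum => i; apply: rderiv_mult.
Qed.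

Lemma vcontinuous_dotv n (v w : R -> 'cV[R]_n) t :
  vcontinuous v t -> vcontinuous w t ->
  continuity_pt (fun u => dotv (v u) (w u)) t.
Proof.
move=> cv cw; apply: (@continuity_pt_ext (fun u => \sum_i v u i 0 * w u i 0)) => [u|].
  by rewrite dotvE.
by apply: continuity_pt_sum => i; apply: continuity_pt_mult.
Qed.

Lemma vrderiv_mulmx p n (M : 'M[R]_(p, n)) v t a : vrderiv v t a ->
  vrderiv (fun u => M *m v u) t (M *m a).
Proof.
move=> va k; rewrite mxE.
apply: (rderiv_ext (fun u => \sum_j M k j * v u j 0)) => [u|]; first by rewrite mxE.
by apply: rderiv_sum => j; apply: rderiv_scal.
Qed.

Lemma vcontinuous_mulmx p n (M : 'M[R]_(p, n)) v t : vcontinuous v t ->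
  vcontinuous (fun u => M *m v u) t.
Proof.
move=> cv k; apply: (@continuity_pt_ext (fun u => \sum_j M k j * v u j 0)) => [u|].
  by rewrite mxE.
by apply: continuity_pt_sum => j; apply: continuity_pt_scal.
Qed.

Lemma exp_scal_derivable (a t : R) :
  derivable_pt_lim (fun u => exp (a * u)) t (exp (a * t) * a).
Proof.
apply: derivable_pt_lim_comp; last exact: derivable_pt_lim_exp.
have := derivable_pt_lim_scal id a t 1 (derivable_pt_lim_id t).
by rewrite Rmult_1_r.
Qed.

(** Symmetry of [H i] makes the right derivative of the form [2 e'H d], so the form times
    [exp (2 lam t)] has nonpositive right derivative and [rderiv_nonpos_le] applies. *)
Lemma quadratic_decay m n (H : 'I_m -> 'M[R]_n) (lam : R) (e d : R -> 'I_m -> 'cV[R]_n) :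
  (forall i, (H i)^T = H i) ->
  (forall t i, 0 < t -> vcontinuous (e^~ i) t) ->
  (forall t i, 0 <= t -> vrderiv (e^~ i) t (d t i)) ->
  (forall t, 0 <= t -> 2 * \sum_i dotv (e t i) (H i *m d t i)
    <= - 2 * lam * \sum_i dotv (e t i) (H i *m e t i)) ->
  forall t, 0 <= t -> \sum_i dotv (e t i) (H i *m e t i)
    <= exp (- 2 * lam * t) * \sum_i dotv (e 0 i) (H i *m e 0 i).
Proof.
move=> symH ce de decr t t0.
pose U u := \sum_i dotv (e u i) (H i *m e u i).
have : exp (2 * lam * t) * U t <= exp (2 * lam * 0) * U 0.
  apply/RleP/(rderiv_nonpos_le (fun u => exp (2 * lam * u) * U u)); last exact/RleP.
    move=> u /RltP u0; apply: continuity_pt_mult.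
      apply: derivable_continuous_pt; exists (exp (2 * lam * u) * (2 * lam)).
      exact: exp_scal_derivable.
    apply: continuity_pt_sum => i; apply: vcontinuous_dotv; first exact: ce.
    by apply: vcontinuous_mulmx; exact: ce.
  move=> u /RleP u0; exists (exp (2 * lam * u) * (2 * lam) * U u
      + exp (2 * lam * u) * (2 * \sum_i dotv (e u i) (H i *m d u i))); split.
    have E0 : 0 <= exp (2 * lam * u) by apply/RleP/Rlt_le/exp_pos.
    have := ler_wpM2l E0 (decr u u0); rewrite -/(U u) => h; apply/RleP.
    rewrite -lerBrDl sub0r; apply: le_trans h _; rewrite le_eqVlt; apply/orP; left.
    by apply/eqP; rewrite !mulNr mulrN !mulrA.
  apply: rderiv_mult; first exact/derivable_rderiv/exp_scal_derivable.
  rewrite mulr_sumr; apply: rderiv_sum => i.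
  have := vrderiv_dotv (de u i u0) (vrderiv_mulmx (H i) (de u i u0)).
  rewrite [dotv (d u i) _]dotv_mulmxr symH dotvC => h.
  by rewrite mulr_natl mulr2n.
rewrite Rmult_0_r exp_0 R1E mul1r -/(U t) -/(U 0) => h.
have E0 : 0 <= exp (- 2 * lam * t) by apply/RleP/Rlt_le/exp_pos.
have := ler_wpM2l E0 h; rewrite mulrA expRD.
rewrite (_ : Rplus _ _ = IZR 0); first by rewrite exp_0 R1E mul1r.
by ring.
Qed.

End Decay.

End ErrorDynamics.

(** * Error estimate for the observer in coordinates *)

Theorem theorem2
  (n m : nat) (s : nat -> nat)
  (A : nat -> nat -> R) (C : nat -> nat -> nat -> R)
  (Pr : nat -> nat -> nat -> R)
  (Pset : Type) (arc : Pset -> nat -> nat -> bool) (lambda : R) :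
  (1 < m)%nat ->
  jointly_observable n m s C A ->
  (forall i, (i < m)%nat -> is_orth_proj n (unobs n (s i) (C i) A) (Pr i)) ->
  (exists l : list Pset, forall p, In p l) ->
  (forall p, strongly_connected m (arc p)) ->
  (forall p, self_loops m (arc p)) ->
  (forall p, doubly_stochastic m (Smat m (arc p))) ->
  0 < lambda ->
  exists K : nat -> nat -> nat -> R,
  exists g0, 0 < g0 /\
  forall g, g0 <= g ->
  exists c, 0 < c /\
  forall (sigma : R -> Pset) (x : R -> nat -> R) (xs : nat -> R -> nat -> R),
    switching_signal sigma ->
    solves n x (fun t => mv n A (x t)) ->
    (forall i, (i < m)%nat ->
       solves n (xs i)
         (fun t k =>
            mv n A (xs i t) k
            + rsum (s i) (fun r => K i k r *
                 (mv n (C i) (xs i t) r - mv n (C i) (x t) r))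
            - g * mv n (Pr i)
                (fun l => xs i t l
                   - rsum m (fun j => Smat m (arc (sigma t)) i j * xs j t l)) k)) ->
    forall t, 0 <= t ->
      err_norm n m (fun i => xs i t) (x t)
        <= c * exp (- lambda * t) * err_norm n m (fun i => xs i 0) (x 0).

Proof.
Import all_boot all_order all_algebra archimedean Rstruct.
Import ObserverDesign ErrorDynamics.
Import Order.TTheory GRing.Theory Num.Theory.
Local Open Scope ring_scope.
move=> _ joint proj [l lP] conn _ dstoch /RltP lam0.
pose A' := mxof n n A; pose C' (i : 'I_m) := mxof (s i) n (C i).
pose P (i : 'I_m) := mxof n n (Pr i).
have projE (i : 'I_m) := unobs_projection (proj i (ssrnat.ltP (ltn_ord i))).
have [||||||||K [g0 g00 hK]] := @observer_lyapunov _ m n (fun i => s i) A' C' P Pset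
  (fun p i j => Smat m (arc p) i j) l lambda lam0.
- by move=> i; case: (projE i).
- by move=> i; case: (projE i).
- by move=> i; case: (projE i).
- by move=> i; case: (projE i).
- move=> x Px; rewrite -(seqvK x); apply/colv_eq0 => k /ssrnat.ltP kn.
  apply: joint kn => i im; apply/unobsE; rewrite seqvK.
  move/ssrnat.ltP in im; rewrite -(Px (Ordinal im)).
  by case: (projE (Ordinal im)).
- exact: lP.
- by move=> p; apply: Smat_stochastic2.
- by move=> p; apply: Smat_connect.
(* Gains are extended by 0 to indices that are not agents. *)
pose Kf i := oapp (fun i' : 'I_m => funmx (K i')) (fun _ _ => 0) (insub i).
have KfE (i : 'I_m) : mxof n (s i) (Kf i) = K i by rewrite /Kf valK funmxK.
exists Kf, g0; split; first exact/RltP.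
move=> g /RleP /hK [H [h [h0 symH Hbound Hdecr]]].
(* From [|e|^2 <= e'He <= h |e|^2]; [h] depends on [g] but is fixed before the switching signal. *)
exists (sqrt h); split; first by apply: sqrt_lt_R0; apply/RltP.
move=> sigma x xs _ solx solxs t /RleP t0.
pose X u := colv n (x u); pose Xs u (i : 'I_m) := colv n (xs i u).
pose e u (i : 'I_m) : 'cV[R]_n := Xs u i - X u.
pose d u (i : 'I_m) : 'cV[R]_n := A' *m e u i + K i *m (C' i *m e u i)
  - g *: (P i *m (e u i - \sum_(j < m) Smat m (arc (sigma u)) i j *: e u j)).
have ce u (i : 'I_m) : 0 < u -> vcontinuous (e^~ i) u.
  move=> /RltP u0 k; have kn := ssrnat.ltP (ltn_ord k).
  apply: (@continuity_pt_ext (fun u => (xs i u k - x u k)%R)) => [v|].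
    by rewrite !mxE.
  have [cx _] := solx k kn; have [cxs _] := solxs i (ssrnat.ltP (ltn_ord i)) k kn.
  by apply: continuity_pt_minus; [exact: cxs | exact: cx].
have de u (i : 'I_m) : 0 <= u -> vrderiv (e^~ i) u (d u i).
  move=> /RleP u0 k; have kn := ssrnat.ltP (ltn_ord k).
  have [_ /(_ u u0) dx] := solx k kn.
  have [_ /(_ u u0) dxs] := solxs i (ssrnat.ltP (ltn_ord i)) k kn.
  have := rderiv_minus _ _ _ _ _ dxs dx.
  set D := Rminus _ _; have -> : D = d u i k 0.
    have -> : d u i = colv n (mv n A (xs i u))
        + colv n (mv (s i) (Kf i) (fun r => mv n (C i) (xs i u) r - mv n (C i) (x u) r))
        - g *: colv n (mv n (Pr i) (fun l => xs i u l
            - rsum m (fun j => Smat m (arc (sigma u)) i j * xs j u l)))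
        - colv n (mv n A (x u)).
      rewrite /d !colv_mv !colvB !colv_mv KfE -/(C' i) -/(P i) -/A' -/(X u) -/(Xs u i).
      have -> : colv n (fun l => rsum m (fun j => Smat m (arc (sigma u)) i j * xs j u l))
          = \sum_(j < m) Smat m (arc (sigma u)) i j *: Xs u j.
        apply/colP => q; rewrite mxE rsumE summxE.
        by apply: eq_bigr => j _; rewrite !mxE.
      (* Unit row sums make the plant state cancel in the coupling, which therefore depends on the
         errors alone. *)
      have [_ row1 _] := Smat_stochastic2 (dstoch (sigma u)).
      have -> : e u i - \sum_(j < m) Smat m (arc (sigma u)) i j *: e u j
          = Xs u i - \sum_(j < m) Smat m (arc (sigma u)) i j *: Xs u j.
        under eq_bigr do rewrite scalerBr.
        by rewrite sumrB -scaler_suml row1 scale1r /e opprB addrA addrNK.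
      rewrite /e !mulmxBr -!addrA; congr (_ + _); rewrite [LHS]addrC -!addrA.
      by congr (_ + _).
    by rewrite /D !mxE.
  by apply: rderiv_ext => v; rewrite !mxE.
have errE u : err_norm n m (fun i => xs i u) (x u) = sqrt (\sum_i dotv (e u i) (e u i)).
  rewrite /err_norm rsumE; congr sqrt; apply: eq_bigr => i _.
  rewrite rsumE dotvE; apply: eq_bigr => k _; rewrite !mxE.
  by rewrite RpowE expr2.
have Udecay := quadratic_decay symH ce de (fun u _ => Hdecr _ _) t0.
rewrite !errE.
have E0 : 0 <= exp (- 2 * lambda * t) by apply/RleP/Rlt_le/exp_pos.
have ee0 u : 0 <= \sum_i dotv (e u i) (e u i).
  by rewrite sumr_ge0 // => i _; exact: dotvv_ge0.
have le_t : \sum_i dotv (e t i) (e t i)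
    <= exp (- 2 * lambda * t) * (h * \sum_i dotv (e 0 i) (e 0 i)).
  apply: le_trans (ler_sum _ _) (le_trans Udecay _) => [i _|].
    by case/andP: (Hbound i (e t i)).
  rewrite ler_wpM2l // mulr_sumr; apply: ler_sum => i _.
  by case/andP: (Hbound i (e 0 i)).
have sqrt_exp : exp (- lambda * t) = sqrt (exp (- 2 * lambda * t)).
  rewrite -[LHS]sqrt_square; last exact/Rlt_le/exp_pos.
  by rewrite -exp_plus; congr (sqrt (exp _)); ring.
rewrite sqrt_exp -sqrt_mult_alt; last exact/Rlt_le/RltP.
rewrite -sqrt_mult_alt; last by apply/RleP; rewrite mulr_ge0 // ltW.
apply: sqrt_le_1_alt; apply/RleP; apply: le_trans le_t _.
by rewrite mulrCA mulrA.
Qed.
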